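(* Let $S$ be a regular $I$-bisimple semitopological semigroup. If $S$ has a maximal subgroup that is compact, then the following statements hold: (i) $S$ is topologically isomorphic to a semigroup $\mathscr{B}_W=\mathbb{Z}\times G\times\mathbb{Z}$ (for some group $G$, endomorphism $\theta$ of $G$ and family $\{u_n\}_{n\in\mathbb{Z}}$ in $G$) with the product topology, where $\mathbb{Z}$ is discrete and $G$ carries the topology of the maximal subgroup $G_{i,i}$; (ii) $S$ is a locally compact topological inverse semigroup.
   Context: All topological spaces are Hausdorff; $\mathbb{N}$ is the set of positive integers. A semitopological semigroup is a Hausdorff topological space with a separately continuous semigroup operation. A topological inverse semigroup is an inverse semigroup with a Hausdorff topology making multiplication jointly continuous and inversion continuous. $E(S)$ is the set of idempotents of $S$, ordered by $e\leqslant f$ iff $ef=fe=e$. A semigroup is bisimple if it has only one $\mathscr{D}$-class (Green's relation). A bisimple semigroup $S$ is $I$-bisimple if $E(S)$ is order isomorphic to $\mathbb{Z}$ under the reverse of the usual order. A semigroup $S$ is regular if $x\in xSx$ for every $x\in S$. A maximal subgroup of $S$ is an $\mathscr{H}$-class containing an idempotent. Given a group $G$ with identity $e$, an endomorphism $\theta$ of $G$ (with $\theta^0=\mathrm{id}_G$) and elements $u_n\in G$ ($n\in\mathbb{Z}$) with $u_n=e$ for $n\in\mathbb{N}$, put $f_{0,n}=e$ and, for $m\in\mathbb{N}$, $n\in\mathbb{Z}$, $$f_{m,n}=\theta^{m-1}(u_{n+1})\cdot\theta^{m-2}(u_{n+2})\cdots\theta(u_{n+(m-1)})\cdot u_{n+m}.$$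 Then $\mathscr{B}_W$ is the set $\mathbb{Z}\times G\times\mathbb{Z}$ with the semigroup operation $$(a,g,b)\cdot(c,h,d)=\begin{cases}(a,\ g\cdot f_{b-c,c}^{-1}\cdot\theta^{b-c}(h)\cdot f_{b-c,d},\ d-c+b), & b\geqslant c,\\ (a-b+c,\ f_{c-b,a}^{-1}\cdot\theta^{c-b}(g)\cdot f_{c-b,b}\cdot h,\ d), & b\leqslant c.\end{cases}$$ For $i,j\in\mathbb{Z}$, $G_{i,j}=\{(i,g,j)\in\mathscr{B}_W\colon g\in G\}$; the maximal subgroups of $\mathscr{B}_W$ are the $G_{i,i}$, and $G$ is identified with $G_{i,i}$ via $g\leftrightarrow(i,g,i)$. (Warne: a regular semigroup is $I$-bisimple iff it is isomorphic to some such $\mathscr{B}_W$.) *)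

(* Defs.v *)
From HB Require Import structures.
From mathcomp Require Import all_boot all_order all_algebra.
From mathcomp Require Import all_classical topology.

Set Implicit Arguments.
Unset Strict Implicit.
Unset Printing Implicit Defensive.

Import Order.TTheory GRing.Theory.

Local Open Scope classical_set_scope.
Local Open Scope group_scope.

(* The two joins below only put an algebraic structure and a topology on the
   same carrier; no compatibility between them is required. *)
#[short(type="preTopologicalSemigroupType")]
HB.structure Definition PreTopologicalSemigroup :=
  {S of Semigroup S & Topological S}.

#[short(type="preTopologicalGroupType")]
HB.structure Definition PreTopologicalGroup :=
  {G of Group G & Topological G}.

Section Semigroup.
Variable S : semigroupType.

(* S^1 x and x S^1, where S^1 is S with an identity adjoined if necessary. *)
Definition left_ideal (x : S) : set S := x |` [set s * x | s in [set: S]].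
Definition right_ideal (x : S) : set S := x |` [set x * s | s in [set: S]].

Definition greenL (x y : S) : Prop := left_ideal x = left_ideal y.
Definition greenR (x y : S) : Prop := right_ideal x = right_ideal y.
Definition greenH (x y : S) : Prop := greenL x y /\ greenR x y.
Definition greenD (x y : S) : Prop := exists2 z, greenL x z & greenR z y.

Definition idempotents : set S := [set e | e * e = e].

Definition idem_le (e f : S) : Prop := e * f = e /\ f * e = e.

Definition regular_semigroup : Prop := forall x : S, exists y, x = x * y * x.

Definition bisimple : Prop := forall x y : S, greenD x y.

Definition I_bisimple : Prop :=
  bisimple /\
  exists e : int -> S, set_bij [set: int] idempotents e /\
    forall i j : int, idem_le (e i) (e j) <-> (j <= i)%R.

Definition maximal_subgroup (A : set S) : Prop :=
  exists2 e, idempotents e & A = [set x | greenH e x].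

Definition inverse_of (x y : S) : Prop := x * y * x = x /\ y * x * y = y.

End Semigroup.

Section TopologicalSemigroup.
Variable S : preTopologicalSemigroupType.

Definition semitopological_semigroup : Prop :=
  [/\ hausdorff_space S,
      forall a : S, continuous (fun x : S => a * x) &
      forall a : S, continuous (fun x : S => x * a)].

(* The equivalence says that [inv x] is the unique inverse of [x]. *)
Definition topological_inverse_semigroup : Prop :=
  [/\ hausdorff_space S,
      continuous (fun p : S * S => p.1 * p.2) &
      exists2 inv : S -> S,
        forall x y : S, inverse_of x y <-> y = inv x & continuous inv].

End TopologicalSemigroup.

Section Warne.
Variables (G : groupType) (theta : {multiplicative G -> G}) (u : int -> G).

Definition warne_f (m : nat) (n : int) : G :=
  \prod_(1 <= k < m.+1) iter (m - k)%N theta (u (n + k%:Z)%R).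

(* The two cases of the usual definition agree when b = c. *)
Definition warne_mul (x y : int * G * int) : int * G * int :=
  let: (a, g, b) := x in
  let: (c, h, d) := y in
  if (c <= b)%R then
    let m := `|b - c|%N in
    (a, g * (warne_f m c)^-1 * iter m theta h * warne_f m d, (d - c + b)%R)
  else
    let m := `|c - b|%N in
    ((a - b + c)%R, (warne_f m a)^-1 * iter m theta g * warne_f m b * h, d).

End Warne.

(* Z x G x Z with the product topology, Z being discrete. *)
Definition warne_space (G : topologicalType) : topologicalType :=
  (discrete_topology int * G * discrete_topology int)%type.

(* [Phi] is a topological isomorphism onto [S] of the semigroup B_W given by
   [theta] and [u]. *)
Definition warne_topological_isomorphism (G : preTopologicalGroupType)
    (theta : {multiplicative G -> G}) (u : int -> G)
    (S : preTopologicalSemigroupType) (Phi : warne_space G -> S) : Prop :=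
  (forall x y : int * G * int,
     Phi (warne_mul theta u x y) = Phi x * Phi y) /\
  exists Psi : S -> warne_space G,
    [/\ cancel Phi Psi, cancel Psi Phi, continuous Phi & continuous Psi].

(* The image of G_{i,i} is a maximal subgroup of S, and the topology of G is
   the one transported from it along g <-> (i, g, i). *)
Definition carries_diagonal_topology (G : preTopologicalGroupType)
    (S : preTopologicalSemigroupType) (Phi : warne_space G -> S) : Prop :=
  forall i : int, let diag := fun g : G => Phi (i, g, i) in
    maximal_subgroup (range diag) /\ (open : set (set G)) = wopen diag.

(* Main.v *)
Require Import Defs.
From HB Require Import structures.
From mathcomp Require Import all_boot all_order all_algebra.
From mathcomp Require Import all_classical topology.
From mathcomp Require Import zify.

(** Algebraically, the idempotents form a chain, so they commute, every element
    has exactly one inverse, and S is graded by the extended bicyclic semigroup: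
    if [x x^* = e_i] and [x^* x = e_j], the pair [(i, j)] depends on [x] through
    a homomorphism to Z x Z with the bicyclic product ([rindexM], [lindexM]).
    The fibres [cell i j] of this grading are the H-classes.  Choosing [coord n]
    in [cell 0 n] for every integer [n], with [coord n] the [n]-th power of one
    element [shift] of [cell 0 1] when [n > 0], every element is uniquely
    [(coord i)^* g (coord j)] with [g] in the group [cell 0 0]; moving [shift]
    past [g] defines the endomorphism [theta], moving it past [coord n] defines
    the elements [u_n], and the product takes Warne's form ([warne_map_mul]).

    Topologically, one compact maximal subgroup makes every cell compact, by
    translation, hence closed.  Every cell is also open ([cell_open]): the set
    where [i] and [j] are not exceeded and [e_i x e_j] lies in [cell i j] is open
    and is the union of the cells [(i - k, j - k)], [k >= 0]; those with [k > 0]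
    are exactly the ones that [x |-> e_(i-1) x e_(j-1)] sends into the closed set
    [cell (i-1) (j-1)].  So S is the topological sum of its cells, and is locally
    compact.

    It remains to see that the compact group [cell 0 0], whose multiplication is
    only separately continuous, is a topological group: this is Ellis's theorem.
    Joint continuity comes from [not_everywhere_split]: a separately continuous
    map on a product of compact spaces cannot oscillate by a fixed amount on
    every nonempty open set of the first variable, since otherwise one could
    build sequences whose two iterated limits differ.  Translations then spread
    the estimate to the identity, and the inverse is continuous because its graph
    is closed and the group is compact.  Finally products and inverses in S are,
    cell by cell, translates of those of [cell 0 0]. *)

Set Implicit Arguments.
Unset Strict Implicit.
Unset Printing Implicit Defensive.

Import Order.TTheory GRing.Theory.

Local Open Scope classical_set_scope.
Local Open Scope group_scope.

(** * General topology *)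

Lemma continuous_pair (T U V : topologicalType) (f : T -> U) (g : T -> V) x :
  {for x, continuous f} -> {for x, continuous g} ->
  {for x, continuous (fun y => (f y, g y))}.
Proof. by move=> cf cg; exact: cvg_pair cf cg. Qed.

Lemma closed_fixed (T : topologicalType) (f : T -> T) :
  hausdorff_space T -> continuous f -> closed [set x | f x = x].
Proof.
move=> hT cf x clx; apply: hT => A B nA nB.
have [z [/= fz [Az Bz]]] := clx _ (@filterI _ (nbhs x) _ _ _ (cf x A nA) nB).
by exists z; split => //; rewrite -fz.
Qed.

(** * Joint continuity in compact semitopological groups *)

Section NoSplitting.
Variables (X Y Z : topologicalType) (f : X -> Y -> Z).
Hypothesis X_compact : compact [set: X].
Hypothesis Y_compact : compact [set: Y].
Hypothesis f_continuousl : forall y, continuous (f^~ y).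
Hypothesis f_continuousr : forall x, continuous (f x).
Variables O F : bool -> set Z.
Hypothesis O_open : forall b, open (O b).
Hypothesis F_closed : forall b, closed (F b).
Hypothesis F_cover : forall z, F true z \/ F false z.
Hypothesis OF_disjoint : forall b z, closure (O b) z -> ~ F b z.

(** [O true] and [O false] are two separated regions of Z; that [f _ y] reaches
    both of them on U replaces a lower bound on its oscillation. *)
Definition splits (U : set X) (y : Y) :=
  forall b, exists2 x, U x & O b (f x y).

Definition everywhere_split (U : set X) (V : set Y) :=
  forall U', open U' -> U' !=set0 -> U' `<=` U -> exists2 y, V y & splits U' y.

(** A Ramsey step: V is covered by two pieces, according to the side on which
    [f x y] lies.  If neither piece split everywhere some open subset of U, then U
    could be shrunk twice so that no [y] of either piece splits the result. *)
Lemma everywhere_split_shrink U V (x : X) :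
  open U -> U !=set0 -> everywhere_split U V ->
  exists b U', [/\ open U', U' !=set0, U' `<=` U &
    everywhere_split U' (V `&` [set y | F b (f x y)])].
Proof.
move=> oU U0 UV; apply: contrapT => no.
have shrink b U1 : open U1 -> U1 !=set0 -> U1 `<=` U ->
    exists U2, [/\ open U2, U2 !=set0, U2 `<=` U1 &
      forall y, V y -> F b (f x y) -> ~ splits U2 y].
  move=> oU1 U10 U1U; apply: contrapT => no2; apply: no.
  exists b, U1; split => // U2 oU2 U20 U21; apply: contrapT => no3.
  apply: no2; exists U2; split => // y Vy Fy sy; apply: no3.
  by exists y.
have [U1 [oU1 U10 U1U no1]] := shrink true U oU U0 (fun _ => id).
have [U2 [oU2 U20 U21 no2]] := shrink false U1 oU1 U10 U1U.
have [y Vy sy] := UV U2 oU2 U20 (subset_trans U21 U1U).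
have [Fy|Fy] := F_cover (f x y); last exact: no2 Vy Fy sy.
apply: no1 Vy Fy _ => b; have [z zU zO] := sy b.
by exists z => //; exact: U21.
Qed.

(** A step of the construction of the two sequences: [stU] and [stV] are where
    all later points are taken, [stx] and [sty] are the points just chosen.  The
    later values [f stx _] stay in [F stb], the later values [f _ sty] in the
    separated region [O stb]. *)
Record stage := Stage {
  stU : set X; stV : set Y; stb : bool; stx : X; sty : Y }.

Definition good_stage p :=
  [/\ open (stU p), stU p !=set0 & everywhere_split (stU p) (stV p)].

Definition refines p q :=
  [/\ stU q `<=` stU p, stV q `<=` stV p, stU p (stx q), stV q (sty q) &
    (forall u, stU q u -> O (stb q) (f u (sty q))) /\
    (forall v, stV q v -> F (stb q) (f (stx q) v))].

Lemma refine_stage p : good_stage p -> exists2 q, good_stage q & refines p q.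
Proof.
move=> [oU U0 UV]; have [x Ux] := U0.
have [b [U' [oU' U'0 U'U U'V]]] := everywhere_split_shrink x oU U0 UV.
have [y [Vy Fy] sy] := U'V U' oU' U'0 (fun _ => id).
have oOy : open [set u | O b (f u y)].
  by apply: open_comp => // u _; exact: f_continuousl.
exists (Stage (U' `&` [set u | O b (f u y)])
              (stV p `&` [set v | F b (f x v)]) b x y).
  split => /=; first exact: openI.
    by have [u Uu Ou] := sy b; exists u.
  move=> W oW W0 WU; apply: U'V => // w /WU [] //.
split => /=.
- by move=> u [/U'U].
- by move=> v [].
- by [].
- by [].
- by split=> [u [_]|v [_]].
Qed.

(** Grothendieck's double limit argument.  Infinitely many stages have the same
    side [b]; along them, [f (s n) (t m)] is in [O b] for [m < n] and in [F b] for
    [n <= m].  At cluster points [x] and [y] of [s] and [t], separate continuity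
    puts [f x y] both in the closure of [O b] and in [F b]. *)
Lemma not_everywhere_split : [set: X] !=set0 -> ~ everywhere_split setT setT.
Proof.
move=> [x0 _] split0.
have [y0 _ _] := split0 setT openT (ex_intro _ x0 I) (fun _ => id).
pose p0 := Stage setT setT true x0 y0.
have good0 : good_stage p0 by split => //; [exact: openT | exists x0].
have /choice [next nextP] :
    forall p, exists q, good_stage p -> good_stage q /\ refines p q.
  move=> p; have [/refine_stage [q gq rq]|ng] := pselect (good_stage p).
    by exists q.
  by exists p => /ng.
pose p n := iter n next p0.
have good n : good_stage (p n).
  by elim: n => [//|n IH]; have [] := nextP _ IH.
have ref n : refines (p n) (p n.+1) by have [] := nextP _ (good n).
have subU m n : (m <= n)%N -> stU (p n) `<=` stU (p m).
  elim: n => [|n IH]; first by rewrite leqn0 => /eqP ->.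
  rewrite leq_eqVlt => /orP [/eqP -> //|]; rewrite ltnS => /IH s.
  by apply: subset_trans s; have [] := ref n.
have subV m n : (m <= n)%N -> stV (p n) `<=` stV (p m).
  elim: n => [|n IH]; first by rewrite leqn0 => /eqP ->.
  rewrite leq_eqVlt => /orP [/eqP -> //|]; rewrite ltnS => /IH s.
  by apply: subset_trans s; have [] := ref n.
pose s n := stx (p n.+1); pose t n := sty (p n.+1); pose c n := stb (p n.+1).
have above m n : (m < n)%N -> O (c m) (f (s n) (t m)).
  move=> mn; have [_ _ _ _ [+ _]] := ref m; apply.
  by apply: (subU _ _ mn); have [] := ref n.
have below m n : (n <= m)%N -> F (c n) (f (s n) (t m)).
  move=> nm; have [_ _ _ _ [_ +]] := ref n; apply.
  by apply: (@subV n.+1 m.+1 nm); have [] := ref m.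
have [b binf] : exists b, forall N, exists2 n, (N <= n)%N & c n = b.
  apply: contrapT => /forallNP fin.
  have fin' b : exists N, forall n, (N <= n)%N -> c n <> b.
    have /existsNP [N HN] := fin b.
    by exists N => n Nn cn; apply: HN; exists n.
  have [[N1 H1] [N2 H2]] := (fin' true, fin' false).
  case cn : (c (maxn N1 N2)); [apply: H1 cn|apply: H2 cn].
    exact: leq_maxl.
  exact: leq_maxr.
pose tail N := [set n | (N <= n)%N /\ c n = b].
pose E := filter_from [set: nat] tail.
have EF : ProperFilter E.
  apply: filter_from_proper; last first.
    by move=> N _; have [n] := binf N; exists n.
  apply: filter_from_filter; first by exists 0%N.
  move=> N1 N2 _ _; exists (maxn N1 N2) => // n [].
  by rewrite geq_max => /andP[n1 n2] cn; split.
have [x [_ clx]] := X_compact (fmap_proper_filter s EF) filterT.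
have [y [_ cly]] := Y_compact (fmap_proper_filter t EF) filterT.
have xin (A : set X) N : closed A -> (forall n, tail N n -> A (s n)) -> A x.
  move=> clA sA; apply: clA; move: clx; rewrite clusterE; apply.
  by exists N.
have yin (A : set Y) N : closed A -> (forall n, tail N n -> A (t n)) -> A y.
  move=> clA tA; apply: clA; move: cly; rewrite clusterE; apply.
  by exists N.
have cll (A : set Z) y' : closed A -> closed [set u | A (f u y')].
  by move=> clA; apply: preimage_closed => // u; exact: f_continuousl.
have clr (A : set Z) x' : closed A -> closed [set v | A (f x' v)].
  by move=> clA; apply: preimage_closed => // v; exact: f_continuousr.
apply: (OF_disjoint (b := b) (z := f x y)).
- apply: (yin [set v | closure (O b) (f x v)] 0%N) => [|m [_ cm]].
    by apply: clr; exact: closed_closure.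
  apply: (xin [set u | closure (O b) (f u (t m))] m.+1) => [|n [mn _]].
    by apply: cll; exact: closed_closure.
  by apply: subset_closure; rewrite -cm; exact: above.
- apply: (xin [set u | F b (f u y)] 0%N) => [|n [_ cn]]; first exact: cll.
  apply: (yin [set v | F b (f (s n) v)] n) => [|m [nm _]]; first exact: clr.
  by rewrite /= -cn; exact: below.
Qed.

End NoSplitting.

Section Ellis.
Variable G : preTopologicalGroupType.
Hypothesis G_hausdorff : hausdorff_space G.
Hypothesis G_compact : compact [set: G].
Hypothesis mul_continuousl : forall a : G, continuous (fun x : G => a * x).
Hypothesis mul_continuousr : forall a : G, continuous (fun x : G => x * a).

Let closed_nbhs (x : G) (N : set G) :
  nbhs x N -> exists2 C, nbhs x C & closed C /\ C `<=` N.
Proof.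
move=> xN.
have [A xA AN] := compact_regular G_hausdorff G_compact filterT xN.
exists (closure A); first exact: filterS (@subset_closure _ A) xA.
by split => //; exact: closed_closure.
Qed.

(** An open U that no [y] splits gives, by right translation by [g^-1] with [g]
    in U, a neighbourhood of 1 whose elements do not move any interior point of C3
    out of C1. *)
Lemma compact_semitopological_group_mul1 (N : set G) :
  nbhs (1 : G) N -> exists2 U : set G * set G,
    nbhs (1 : G) U.1 /\ nbhs (1 : G) U.2 &
    forall u v, U.1 u -> U.2 v -> N (u * v).
Proof.
move=> N1.
have [C1 nC1 [clC1 C1N]] := closed_nbhs N1.
have [C2 nC2 [clC2 C21]] := closed_nbhs (nbhs_interior nC1).
have [C3 nC3 [clC3 C32]] := closed_nbhs (nbhs_interior nC2).
(* The three nested closed neighbourhoods leave room between C3 and the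
   complement of C1 for the closed cover formed by C2 and the complement of its
   interior. *)
pose O b := if b then C3° else ~` C1.
pose F b := if b then ~` C2° else C2.
have oO b : open (O b).
  by case: b; [exact: open_interior | exact: closed_openC].
have cF b : closed (F b).
  by case: b => //; apply: open_closedC; exact: open_interior.
have FT z : F true z \/ F false z.
  rewrite /F; have [/interior_subset|] := pselect (C2° z); by [right|left].
have OF b z : closure (O b) z -> ~ F b z.
  case: b => /=.
    move=> Oz; apply; apply: C32; apply: clC3.
    by apply: closureS Oz; exact: interior_subset.
  by rewrite closure_setC => h /C21.
have noTT := not_everywhere_split (X := G) (Y := G) (f := fun x y => x * y)
  G_compact G_compact mul_continuousr mul_continuousl oO cF FT OF
  (ex_intro _ (1 : G) I).
have [U [oU [g Ug] noU]] : exists U : set G, [/\ open U, U !=set0 &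
    forall y, ~ splits (fun x y => x * y) O U y].
  apply: contrapT => no; apply: noTT => U oU U0 _.
  apply: contrapT => no2; apply: no; exists U; split => // y sy.
  by apply: no2; exists y.
exists ([set u | U (u * g)], C3°).
  split; last exact: nbhs_interior.
  apply: open_nbhs_nbhs; split; last by rewrite /= mul1g.
  by apply: open_comp => // x _; exact: mul_continuousr.
move=> u v /= Uu Cv; apply: C1N; apply: contrapT => nC.
(* Otherwise [g^-1 * v] would split U, through [g] and [u * g]. *)
apply: (noU (g^-1 * v)) => -[].
  by exists g => //=; rewrite mulVKg.
by exists (u * g) => //=; rewrite -mulgA mulVKg.
Qed.

(** Separate continuity transports continuity at the identity to [(a, b)], as
    [x y = a (a^-1 x) (y b^-1) b]. *)
Theorem compact_semitopological_group_mul :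
  continuous (fun p : G * G => p.1 * p.2).
Proof.
move=> [a b] N /= Nab.
have /compact_semitopological_group_mul1 [[U V] /= [nU nV] UV] :
    nbhs (1 : G) [set z | N (a * z * b)].
  apply: (@mul_continuousl a 1 [set z | N (z * b)]).
  by apply: (@mul_continuousr b (a * 1) N); rewrite mulg1.
exists ([set x | U (a^-1 * x)], [set y | V (y * b^-1)]) => /=.
  split; [apply: (mul_continuousl (a := a^-1)) | apply: (mul_continuousr (a := b^-1))].
    by rewrite mulVg.
  by rewrite mulgV.
move=> [x y] /= [Ux Vy]; have /= := UV _ _ Ux Vy.
by rewrite !mulgA mulgV mul1g mulgVK.
Qed.

(** The tube lemma, applied to the closed set of [y] outside a neighbourhood of
    [g^-1] and to the open condition [u y <> 1]. *)
Theorem compact_semitopological_group_inv : continuous (fun x : G => x^-1).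
Proof.
move=> g N; rewrite nbhsE => -[O [oO Og ON]].
have /compact_near_coveringP cov : compact (~` O).
  by apply: (subclosed_compact _ G_compact) => //; exact: open_closedC.
have : \forall u \near g, forall y, (~` O) y -> u * y <> 1.
  apply: (cov _ (nbhs g) (fun u y => u * y <> 1)) => y Oy.
  have ne : y * g <> 1.
    move=> e; apply: Oy; rewrite (_ : y = g^-1) //.
    by rewrite -[y](mulgK g) e mul1g.
  have ne' : g * y <> 1.
    by move=> e; apply: ne; rewrite -[y](mulKg g) e mulg1 mulVg.
  have [|[A B] /= [nA nB] AB] :=
    @compact_semitopological_group_mul (g, y : G) (~` [set (1 : G)]).
    apply: open_nbhs_nbhs; split => //; apply: closed_openC.
    by apply: compact_closed => //; exact: compact_set1.
  exists (B, A) => //= -[y' u] /= [By Au].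
  by apply: (AB (u, y')).
apply: filterS => u no; apply: ON; apply: contrapT => nO.
by apply: (no _ nO); rewrite mulgV.
Qed.

End Ellis.

(** * Algebra of regular I-bisimple semigroups *)

(** Rigidity of chains of type N: used to see that conjugation acts on the
    idempotents by a shift. *)
Lemma enumeration_shift (f : nat -> int) :
  (forall m n, (m < n)%N -> (f m < f n)%R) ->
  (forall j, (f 0%N <= j)%R -> exists n, f n = j) ->
  forall n, f n = (f 0%N + n%:Z)%R.
Proof.
move=> f_incr f_surj; elim=> [|n IH]; first by rewrite addr0.
have [m fm] := f_surj (f 0%N + n.+1%:Z)%R ltac:(lia).
have lt1 := f_incr n n.+1 (leqnn _).
have [|nm|eqm] := ltngtP m n.+1; last by rewrite -fm eqm.
  rewrite ltnS leq_eqVlt => /orP[/eqP eqm|/f_incr]; last lia.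
  by move: fm; rewrite eqm; lia.
by have := f_incr _ _ nm; lia.
Qed.

(** The enumeration of the idempotents is determined up to a shift; it is fixed
    here because all the coordinates below are read off from it. *)
Record regular_I_bisimple (S : semigroupType) := RegularIBisimple {
  idem : int -> S;
  idem_bij : set_bij [set: int] (@idempotents S) idem;
  idem_leP : forall i j : int, idem_le (idem i) (idem j) <-> (j <= i)%R;
  semigroup_regular : regular_semigroup S;
  semigroup_bisimple : bisimple S }.

Section IBisimpleAlgebra.
Variables (S : semigroupType) (D : regular_I_bisimple S).
Local Notation e := (idem D).

Lemma e_idem i : e i * e i = e i.
Proof. by have [h _ _] := idem_bij D; exact: (h i). Qed.

Lemma e_inj : injective e.
Proof. by have [_ h _] := idem_bij D; move=> i j; apply: h; rewrite inE. Qed.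

Lemma e_surj (x : S) : x * x = x -> exists i, x = e i.
Proof. by have [_ _ h] := idem_bij D; move=> /h [i _ <-]; exists i. Qed.

Lemma e_mul i j : e i * e j = e (Order.max i j).
Proof.
have [ij|/ltW ji] := leP i j; first by have [] := (idem_leP D j i).2 ij.
by have [] := (idem_leP D i j).2 ji.
Qed.

Lemma idem_comm (x y : S) : x * x = x -> y * y = y -> x * y = y * x.
Proof.
by move=> /e_surj [i ->] /e_surj [j ->]; rewrite !e_mul; congr e; lia.
Qed.

Lemma inverse_exists (x : S) : exists y, inverse_of x y.
Proof.
have [y /esym xyx] := semigroup_regular D x; exists (y * x * y).
have xyxK z : x * (y * (x * z)) = x * z by rewrite !mulgA xyx.
by split; rewrite -?mulgA !xyxK // mulgA.
Qed.

Definition inverse (x : S) : S := sval (cid (inverse_exists x)).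
Local Notation "x ^*" := (inverse x) : group_scope.

Lemma inverseP (x : S) : inverse_of x x^*.
Proof. by rewrite /inverse; case: cid. Qed.

Lemma inverseKr (x : S) : x * x^* * x = x.
Proof. by case: (inverseP x). Qed.

Lemma inverseKl (x : S) : x^* * x * x^* = x^*.
Proof. by case: (inverseP x). Qed.

Lemma inverse_of_idem (x y : S) :
  inverse_of x y -> (x * y) * (x * y) = x * y /\ (y * x) * (y * x) = y * x.
Proof. by move=> [xyx yxy]; rewrite !mulgA xyx yxy. Qed.

Lemma inverse_unique (x y z : S) : inverse_of x y -> inverse_of x z -> y = z.
Proof.
move=> xy xz; have [ixy iyx] := inverse_of_idem xy.
have [ixz izx] := inverse_of_idem xz; move: xy xz => [xyx yxy] [xzx zxz].
have -> : y = y * x * z.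
  rewrite -[LHS]yxy -[in LHS]xzx.
  transitivity (y * ((x * z) * (x * y))); first by rewrite !mulgA.
  by rewrite (idem_comm ixz ixy) !mulgA yxy.
rewrite -[RHS]zxz -[in RHS]xyx.
transitivity ((y * x) * (z * x) * z); last by rewrite (idem_comm iyx izx) !mulgA.
by rewrite -[RHS]mulgA zxz.
Qed.

Lemma inverseE (x y : S) : inverse_of x y -> x^* = y.
Proof. exact: inverse_unique (inverseP x). Qed.

Lemma inverseK (x : S) : x^*^* = x.
Proof. by apply: inverseE; split; rewrite (inverseKl, inverseKr). Qed.

Lemma inverse_idem (x : S) : x * x = x -> x^* = x.
Proof. by move=> xx; apply: inverseE; split; rewrite !xx. Qed.

Lemma idem_mulxV (x : S) : x * x^* * (x * x^*) = x * x^*.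
Proof. by have [] := inverse_of_idem (inverseP x). Qed.

Lemma idem_mulVx (x : S) : x^* * x * (x^* * x) = x^* * x.
Proof. by have [] := inverse_of_idem (inverseP x). Qed.

Lemma inverseM (x y : S) : (x * y)^* = y^* * x^*.
Proof.
have comm := idem_comm (idem_mulVx x) (idem_mulxV y).
apply: inverseE; split.
  transitivity (x * ((y * y^*) * (x^* * x)) * y); first by rewrite !mulgA.
  by rewrite -comm !mulgA inverseKr -[in RHS](inverseKr y) !mulgA.
transitivity (y^* * ((x^* * x) * (y * y^*)) * x^*); first by rewrite !mulgA.
by rewrite comm !mulgA inverseKl -[in RHS](inverseKl x) !mulgA.
Qed.

(** The index of the idempotent generating the right ideal of [x], and
    symmetrically for [lindex] and the left ideal; both read in Z. *)
Definition rindex (x : S) : int := sval (cid (e_surj (idem_mulxV x))).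
Definition lindex (x : S) : int := rindex x^*.

Lemma e_rindex (x : S) : e (rindex x) = x * x^*.
Proof. by rewrite /rindex; case: cid. Qed.

Lemma e_lindex (x : S) : e (lindex x) = x^* * x.
Proof. by rewrite e_rindex inverseK. Qed.

Lemma lindexV (x : S) : lindex x^* = rindex x.
Proof. by rewrite /lindex inverseK. Qed.

Lemma rindex_e i : rindex (e i) = i.
Proof. by apply: e_inj; rewrite e_rindex inverse_idem e_idem. Qed.

Lemma lindex_e i : lindex (e i) = i.
Proof. by rewrite /lindex inverse_idem ?rindex_e ?e_idem. Qed.

Lemma e_mulP i (x : S) : e i * x = x <-> (i <= rindex x)%R.
Proof.
have ex : e (rindex x) * x = x by rewrite e_rindex inverseKr.
split=> [eix|le].
  have : e i * e (rindex x) = e (rindex x) by rewrite e_rindex mulgA eix.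
  by rewrite e_mul => /e_inj; lia.
by rewrite -ex mulgA e_mul; congr (e _ * _); lia.
Qed.

Lemma mul_eP i (x : S) : x * e i = x <-> (i <= lindex x)%R.
Proof.
rewrite -e_mulP; have eV : (e i)^* = e i by rewrite inverse_idem ?e_idem.
split=> [|/(congr1 inverse)]; last by rewrite inverseM inverseK eV.
by move=> /(congr1 inverse); rewrite inverseM eV.
Qed.

(* The conjugation [x^* _ x] is an order isomorphism from the idempotents below [x x^*]
   onto those below [x^* x], and a chain of type N is rigid. *)
(** Conjugation by [x] is an order isomorphism from the idempotents below
    [x x^*] onto those below [x^* x]; both are chains of type N, so it can only
    shift the index. *)
Lemma conj_e (x : S) (n : nat) :
  x^* * e (rindex x + n%:Z)%R * x = e (lindex x + n%:Z)%R.
Proof.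
have xe k : x * (x^* * e (rindex x + k%:Z)%R) = e (rindex x + k%:Z)%R.
  by rewrite mulgA -e_rindex e_mul; congr e; lia.
have conjM k m : (x^* * e (rindex x + k%:Z)%R * x) * (x^* * e (rindex x + m%:Z)%R * x)
    = x^* * e (rindex x + (maxn k m)%:Z)%R * x.
  rewrite -mulgA [x * (_ * x)]mulgA xe mulgA -[_ * e _ * e _]mulgA e_mul.
  by congr (_ * e _ * _); lia.
have /choice [f fE] k : exists i, x^* * e (rindex x + k%:Z)%R * x = e i.
  by apply: e_surj; rewrite conjM maxnn.
have f0 : f 0%N = lindex x.
  by apply: e_inj; rewrite -fE addr0 e_rindex e_lindex !mulgA inverseKl.
have f_inj k m : f k = f m -> k = m.
  move=> fkm; suff : e (rindex x + k%:Z)%R = e (rindex x + m%:Z)%R.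
    by move=> /e_inj; lia.
  have ex j : x * e (f j) * x^* = e (rindex x + j%:Z)%R.
    rewrite -fE !mulgA -e_rindex -[_ * x * x^*]mulgA -e_rindex !e_mul.
    by congr e; lia.
  by rewrite -!ex fkm.
rewrite -f0 -(enumeration_shift (f := f)) => [|m k mk|j].
- exact: fE.
- have : f k = Order.max (f m) (f k).
    by apply: e_inj; rewrite -e_mul -!fE conjM; congr (_ * e _ * _); lia.
  have : f m <> f k by move=> /f_inj; lia.
  by lia.
rewrite f0 => lej.
have [i xi] : exists i, x * e j * x^* = e i.
  apply: e_surj.
  transitivity (x * (e j * (x^* * x) * e j) * x^*); first by rewrite !mulgA.
  by rewrite -e_lindex !e_mul; congr (_ * e _ * _); lia.
have le : (rindex x <= i)%R.
  have : e (rindex x) * e i = e i by rewrite -xi e_rindex !mulgA inverseKr.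
  by rewrite e_mul => /e_inj; lia.
exists `|i - rindex x|%N; apply: e_inj; rewrite -fE.
rewrite (_ : (rindex x + _)%R = i) -?xi; last lia.
rewrite !mulgA -e_lindex -[_ * x^* * x]mulgA -e_lindex !e_mul.
by congr e; lia.
Qed.

(** With [lindexM], the product rule of the extended bicyclic semigroup. *)
Lemma rindexM (x y : S) :
  rindex (x * y) = Order.max (rindex x) (rindex x + rindex y - lindex x)%R.
Proof.
apply: e_inj; rewrite e_rindex inverseM -!mulgA [y * (_ * _)]mulgA -e_rindex.
have [le|/ltW le] := leP (rindex y) (lindex x).
  by rewrite mulgA (mul_eP _ x).2 // -e_rindex; congr e; lia.
have := conj_e x^* `|rindex y - lindex x|%N; rewrite inverseK lindexV -mulgA.
rewrite (_ : (rindex x^* + _)%R = rindex y) => [->|]; last first.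
  by rewrite -/(lindex x); lia.
by congr e; lia.
Qed.

Lemma lindexM (x y : S) :
  lindex (x * y) = Order.max (lindex y) (lindex y + lindex x - rindex y)%R.
Proof. by rewrite /lindex inverseM rindexM lindexV. Qed.

Lemma rindexV (x : S) : rindex x^* = lindex x.
Proof. by []. Qed.

Lemma greenRP (x y : S) : greenR x y <-> rindex x = rindex y.
Proof.
have idealE z : right_ideal z = [set w | e (rindex z) * w = w].
  rewrite eqEsubset; split=> [w [->|[s _ <-]]|w /= <-] /=.
  - by rewrite e_rindex inverseKr.
  - by rewrite mulgA e_rindex inverseKr.
  - by right; exists (z^* * w) => //; rewrite mulgA e_rindex.
rewrite /greenR !idealE; split=> [E|-> //].
have le z : e (rindex z) * e (rindex z) = e (rindex z) by rewrite e_idem.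
have := le x; have := le y.
rewrite -[_ = _]/([set w | e (rindex y) * w = w] _) -E /= e_mul => /e_inj h1.
rewrite -[_ = _]/([set w | e (rindex x) * w = w] _) E /= e_mul => /e_inj h2.
lia.
Qed.

Lemma greenLP (x y : S) : greenL x y <-> lindex x = lindex y.
Proof.
have idealE z : left_ideal z = [set w | w * e (lindex z) = w].
  rewrite eqEsubset; split=> [w [->|[s _ <-]]|w /= <-] /=.
  - by rewrite e_lindex mulgA inverseKr.
  - by rewrite -mulgA e_lindex [z * _]mulgA inverseKr.
  - by right; exists (w * z^*) => //; rewrite -mulgA e_lindex.
rewrite /greenL !idealE; split=> [E|-> //].
have le z : e (lindex z) * e (lindex z) = e (lindex z) by rewrite e_idem.
have := le x; have := le y.
rewrite -[_ = _]/([set w | w * e (lindex y) = w] _) -E /= e_mul => /e_inj h1.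
rewrite -[_ = _]/([set w | w * e (lindex x) = w] _) E /= e_mul => /e_inj h2.
lia.
Qed.

Definition cell (i j : int) : set S := [set x | rindex x = i /\ lindex x = j].

Lemma maximal_subgroupP (A : set S) :
  maximal_subgroup A <-> exists i, A = cell i i.
Proof.
have cellE i : [set x | greenH (e i) x] = cell i i.
  rewrite eqEsubset; split=> x; rewrite /greenH /cell /= greenLP greenRP.
    by rewrite rindex_e lindex_e => -[<- <-].
  by rewrite rindex_e lindex_e => -[-> ->].
split=> [[f /e_surj [i ->] ->]|[i ->]]; first by exists i.
by exists (e i) => //; exact: e_idem.
Qed.

Lemma cell_nonempty i j : cell i j !=set0.
Proof.
have [x /greenLP + /greenRP] := semigroup_bisimple D (e j) (e i).
by rewrite rindex_e lindex_e => lx rx; exists x; split.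
Qed.

End IBisimpleAlgebra.

(** * Warne coordinates *)

Section WarneCoordinates.
Variables (S : preTopologicalSemigroupType) (D : regular_I_bisimple S).

Local Notation e := (idem D).
Local Notation "x ^*" := (inverse D x) : group_scope.
Local Notation rindex := (rindex D).
Local Notation lindex := (lindex D).
Local Notation cell := (cell D).

Lemma cellM i j k l x y : cell i j x -> cell k l y ->
  cell (Order.max i (i + k - j)%R) (Order.max l (l + j - k)%R) (x * y).
Proof. by move=> [<- <-] [<- <-]; split; rewrite (rindexM, lindexM). Qed.

Lemma cell_cast i j i' j' x : cell i j x -> i = i' -> j = j' -> cell i' j' x.
Proof. by move=> cx <- <-. Qed.

Lemma cellMM i j l x y : cell i j x -> cell j l y -> cell i l (x * y).
Proof.
by move=> cx cy; apply: cell_cast (cellM cx cy) _ _; lia.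
Qed.

Lemma cellV i j x : cell i j x -> cell j i x^*.
Proof. by move=> [<- <-]; split; rewrite (rindexV, lindexV). Qed.

Lemma e_mul_cell i j x : cell i j x -> e i * x = x.
Proof. by move=> [<- _]; apply/(e_mulP D). Qed.

Lemma mul_e_cell i j x : cell i j x -> x * e j = x.
Proof. by move=> [_ <-]; apply/(mul_eP D). Qed.

Lemma mulxV_cell i j x : cell i j x -> x * x^* = e i.
Proof. by move=> [<- _]; rewrite e_rindex. Qed.

Lemma mulVx_cell i j x : cell i j x -> x^* * x = e j.
Proof. by move=> [_ <-]; rewrite e_lindex. Qed.

Lemma e_cell i : cell i i (e i).
Proof. by split; rewrite (rindex_e, lindex_e). Qed.

(** The H-class of [e 0], as a group with the topology induced from S. *)
Definition core : Type := set_type (cell 0%R 0%R).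

HB.instance Definition _ := Choice.on core.
HB.instance Definition _ := Topological.copy core (initial_topology (set_val : core -> S)).

Definition Core x (cx : cell 0%R 0%R x) : core := exist _ x (mem_set cx).

Lemma coreP (g : core) : cell 0%R 0%R (set_val g).
Proof. exact: set_valP. Qed.

Lemma core_valE x (cx : cell 0%R 0%R x) : set_val (Core cx) = x.
Proof. by []. Qed.

Lemma core_inj (g h : core) : set_val g = set_val h -> g = h.
Proof. exact: val_inj. Qed.

Definition core_mul (g h : core) : core := Core (cellMM (coreP g) (coreP h)).
Definition core_one : core := Core (e_cell 0%R).
Definition core_inv (g : core) : core := Core (cellV (coreP g)).

Lemma core_mulA : associative core_mul.
Proof. by move=> x y z; apply: core_inj; exact: mulgA. Qed.
Lemma core_mul1 : left_id core_one core_mul.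
Proof. by move=> x; apply: core_inj; exact: e_mul_cell (coreP x). Qed.
Lemma core_mulr1 : right_id core_one core_mul.
Proof. by move=> x; apply: core_inj; exact: mul_e_cell (coreP x). Qed.
Lemma core_mulV : left_inverse core_one core_inv core_mul.
Proof. by move=> x; apply: core_inj; exact: mulVx_cell (coreP x). Qed.
Lemma core_mulrV : right_inverse core_one core_inv core_mul.
Proof. by move=> x; apply: core_inj; exact: mulxV_cell (coreP x). Qed.

HB.instance Definition _ := isGroup.Build core
  core_mulA core_mul1 core_mulr1 core_mulV core_mulrV.

HB.instance Definition _ := PreTopologicalGroup.on core.

Lemma core_valM (g h : core) : set_val (g * h) = set_val g * set_val h.
Proof. by []. Qed.

Lemma core_valV (g : core) : set_val g^-1 = (set_val g)^*.
Proof. by []. Qed.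

(** This element generates, with its inverse, a bicyclic submonoid of
    [e 0 * S * e 0]. *)
Definition shift : S := sval (cid (cell_nonempty D 0%R 1%R)).

Lemma shift_cell : cell 0%R 1%R shift.
Proof. by rewrite /shift; case: cid. Qed.

Definition shift_pow (n : nat) : S := iter n ( *%g shift) (e 0%R).

Lemma shift_pow_cell n : cell 0%R n%:Z%R (shift_pow n).
Proof. 
elim: n => [|n IH]; first exact: e_cell.
by apply: cell_cast (cellM shift_cell IH) _ _; lia.
Qed.

(** Taking powers of [shift] at the nonnegative indices is what makes [u_n]
    trivial for [n > 0]. *)
Definition coord (n : int) : S :=
  if n is Posz m then shift_pow m
  else sval (cid (cell_nonempty D 0%R n)).

Lemma coord_cell n : cell 0%R n (coord n).
Proof.
case: n => n; first exact: shift_pow_cell.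
by rewrite /coord; case: cid.
Qed.

Lemma shift_core_cell x : cell 0%R 0%R x -> cell 0%R 0%R (shift * x * shift^*).
Proof.
move=> cx; apply: cellMM (cellV shift_cell).
by apply: cell_cast (cellM shift_cell cx) _ _; lia.
Qed.

Definition theta (g : core) : core := Core (shift_core_cell (coreP g)).

Lemma shift_mul (g : core) : shift * set_val g = set_val (theta g) * shift.
Proof.
rewrite /= -[RHS]mulgA (mulVx_cell shift_cell); symmetry.
have c : cell 0%R 1%R (shift * set_val g).
  by apply: cell_cast (cellM shift_cell (coreP g)) _ _; lia.
by apply: mul_e_cell c.
Qed.

Lemma thetaM : {morph theta : g h / g * h}.
Proof.
move=> g h; apply: core_inj; change (shift * (set_val g * set_val h) * shift^*
  = set_val (theta g) * (shift * set_val h * shift^*)).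
by rewrite mulgA [shift * set_val g]shift_mul !mulgA.
Qed.

Lemma theta1 : theta 1 = 1.
Proof. by apply: (mulgI (theta 1)); rewrite -thetaM !mulg1. Qed.

HB.instance Definition _ := isMultiplicative.Build core core theta thetaM.

(** The family u: [shift * coord (n - 1)] and [coord n] lie in the same H-class,
    and [u_n] is the element of the group that compares them. *)
Lemma ladder_cell n : cell 0%R 0%R (shift * coord (n - 1)%R * (coord n)^*).
Proof.
apply: cellMM (cellV (coord_cell n)).
by apply: cell_cast (cellM shift_cell (coord_cell (n - 1)%R)) _ _; lia.
Qed.

Definition ladder (n : int) : core := Core (ladder_cell n).

Lemma shift_coord n : shift * coord n = set_val (ladder (n + 1)%R) * coord (n + 1)%R.
Proof.
rewrite core_valE addrK -[RHS]mulgA (mulVx_cell (coord_cell _)); symmetry.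
apply: (mul_e_cell (i := 0%R)).
by apply: cell_cast (cellM shift_cell (coord_cell n)) _ _; lia.
Qed.

Lemma ladder_pos n : (0 < n)%R -> ladder n = 1.
Proof.
case: n => [[//|n]|//] _; apply: core_inj.
rewrite core_valE (_ : (n.+1%:Z - 1)%R = n%:Z%R); last lia.
exact: mulxV_cell (coord_cell n.+1).
Qed.

Lemma shift_pow_core m (g : core) :
  shift_pow m * set_val g = set_val (iter m theta g) * shift_pow m.
Proof.
elim: m => [|m IH].
  by rewrite (e_mul_cell (coreP g)) (mul_e_cell (coreP g)).
by rewrite /= -mulgA IH mulgA shift_mul mulgA.
Qed.

Lemma warne_fS (m : nat) (n : int) :
  warne_f theta ladder m.+1 n
  = theta (warne_f theta ladder m n) * ladder (n + m.+1%:Z)%R.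
Proof.
rewrite /warne_f big_nat_recr //= subnn; congr (_ * _).
rewrite (big_morph theta thetaM theta1).
by apply: eq_big_nat => k /andP[_ km]; rewrite subSn.
Qed.

(** Warne's [f_(m,n)] is the factor that appears when [shift ^ m] is moved along
    the ladder from [coord n] to [coord (n + m)]. *)
Lemma shift_pow_coord m n :
  shift_pow m * coord n = set_val (warne_f theta ladder m n) * coord (n + m%:Z)%R.
Proof.
elim: m => [|m IH].
  rewrite (e_mul_cell (coord_cell n)) addr0 /warne_f big_geq //.
  by rewrite (e_mul_cell (coord_cell n)).
rewrite warne_fS core_valM -[LHS]mulgA IH [LHS]mulgA shift_mul -[LHS]mulgA.
by rewrite shift_coord [LHS]mulgA -addrA (_ : (m%:Z + 1)%R = m.+1%:Z%R) //; lia.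
Qed.

Definition warne_map (p : warne_space core) : S :=
  (coord p.1.1)^* * set_val p.1.2 * coord p.2.

Lemma warne_map_cell i g j : cell i j (warne_map (i, g, j)).
Proof.
exact: cellMM (cellMM (cellV (coord_cell i)) (coreP g)) (coord_cell j).
Qed.

(** The middle factor of a product of two elements in coordinate form, according
    to which of the two inner indices is larger. *)
Lemma coord_mulV_le (b : int) m :
  coord (b + m%:Z)%R * (coord b)^*
  = set_val (warne_f theta ladder m b)^-1 * shift_pow m.
Proof.
rewrite core_valV.
transitivity ((set_val (warne_f theta ladder m b))^*
   * (shift_pow m * coord b) * (coord b)^*).
  rewrite shift_pow_coord mulgA (mulVx_cell (coreP _)).
  by rewrite (e_mul_cell (coord_cell _)).
rewrite -!mulgA (mulxV_cell (coord_cell _)).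
congr (_ * _); apply/(mul_eP D).
by have [_ ->] := shift_pow_cell m.
Qed.

Lemma coord_mulV_gt (b : int) m :
  coord b * (coord (b + m%:Z)%R)^*
  = (shift_pow m)^* * set_val (warne_f theta ladder m b).
Proof.
have := congr1 (inverse D) (coord_mulV_le b m).
by rewrite core_valV !inverseM !inverseK.
Qed.

Lemma core_shift_powV m (g : core) :
  set_val g * (shift_pow m)^* = (shift_pow m)^* * set_val (iter m theta g).
Proof.
have c : cell m%:Z%R 0%R (set_val g * (shift_pow m)^*).
  by apply: cell_cast (cellM (coreP g) (cellV (shift_pow_cell m))) _ _; lia.
rewrite -(e_mul_cell c) -(mulVx_cell (shift_pow_cell m)) -mulgA.
rewrite [shift_pow m * _]mulgA shift_pow_core -[X in _ * X]mulgA.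
by rewrite (mulxV_cell (shift_pow_cell m)) (mul_e_cell (coreP _)).
Qed.

Lemma coordV_shift_powV m a :
  (coord a)^* * (shift_pow m)^*
  = (coord (a + m%:Z)%R)^* * set_val (warne_f theta ladder m a)^-1.
Proof. by rewrite -inverseM shift_pow_coord inverseM core_valV. Qed.

Lemma warne_map_mul (x y : int * core * int) :
  warne_map (warne_mul theta ladder x y) = warne_map x * warne_map y.
Proof.
case: x y => [[a g] b] [[c h] d]; rewrite /warne_map /warne_mul /=.
have [cb|bc] := leP c b.
  set m := `|b - c|%N; have -> : b = (c + m%:Z)%R by lia.
  transitivity ((coord a)^* * set_val g * (coord (c + m%:Z)%R * (coord c)^*)
    * set_val h * coord d); last by rewrite !mulgA.
  rewrite coord_mulV_le /= !core_valM -!mulgA; do 3 congr (_ * _).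
  rewrite [shift_pow m * (_ * _)]mulgA shift_pow_core -!mulgA; congr (_ * _).
  by rewrite shift_pow_coord; congr (_ * coord _); lia.
set m := `|c - b|%N; have -> : c = (b + m%:Z)%R by lia.
transitivity ((coord a)^* * set_val g * (coord b * (coord (b + m%:Z)%R)^*)
    * set_val h * coord d); last by rewrite !mulgA.
rewrite coord_mulV_gt /= !core_valM.
transitivity ((coord a)^* * (set_val g * (shift_pow m)^*)
    * set_val (warne_f theta ladder m b) * set_val h * coord d); last first.
  by rewrite !mulgA.
rewrite core_shift_powV [in RHS]mulgA coordV_shift_powV.
rewrite (_ : (a - b + _)%R = (a + m%:Z)%R); last lia.
by rewrite !mulgA.
Qed.

Lemma core_of_cell s : cell 0%R 0%R (coord (rindex s) * s * (coord (lindex s))^*).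
Proof.
have cs : cell (rindex s) (lindex s) s by [].
exact: cellMM (cellMM (coord_cell _) cs) (cellV (coord_cell _)).
Qed.

Definition warne_coordinates (s : S) : warne_space core :=
  (rindex s, Core (core_of_cell s), lindex s).

Lemma warne_mapK : cancel warne_map warne_coordinates.
Proof.
move=> [[i g] j]; have [ri lj] := warne_map_cell i g j.
have E : set_val (Core (core_of_cell (warne_map (i, g, j)))) = set_val g.
  rewrite core_valE ri lj /warne_map /=.
  transitivity ((coord i * (coord i)^*) * set_val g * (coord j * (coord j)^*)).
    by rewrite !mulgA.
  rewrite !(mulxV_cell (coord_cell _)) (e_mul_cell (coreP g)).
  exact: mul_e_cell (coreP g).
by rewrite /warne_coordinates (core_inj E) ri lj.
Qed.

Lemma warne_coordinatesK : cancel warne_coordinates warne_map.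
Proof.
move=> s; rewrite /warne_map /warne_coordinates [fst _]/= [snd _]/= core_valE.
have cs : cell (rindex s) (lindex s) s by [].
transitivity (((coord (rindex s))^* * coord (rindex s)) * s
  * ((coord (lindex s))^* * coord (lindex s))); first by rewrite !mulgA.
rewrite !(mulVx_cell (coord_cell _)) (e_mul_cell cs).
exact: mul_e_cell cs.
Qed.

Lemma range_warne_map i : range (fun g : core => warne_map (i, g, i)) = cell i i.
Proof.
rewrite eqEsubset; split=> [_ [g _ <-]|s [ri li]]; first exact: warne_map_cell.
exists (Core (core_of_cell s)) => //; rewrite -[RHS]warne_coordinatesK.
by congr (warne_map (_, _, _)); rewrite (ri, li).
Qed.

(** * Topology of the cells *)

Hypothesis S_semitop : semitopological_semigroup S.

Let S_hausdorff : hausdorff_space S.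
Proof. by case: S_semitop. Qed.

Let lmul_continuous (a : S) : continuous (fun x : S => a * x).
Proof. by case: S_semitop. Qed.

Let rmul_continuous (a : S) : continuous (fun x : S => x * a).
Proof. by case: S_semitop. Qed.

Let lrmul_continuous (a b : S) : continuous (fun x : S => a * x * b).
Proof.
move=> x; apply: (continuous_comp (f := fun x : S => a * x) (g := fun x => x * b)).
  exact: lmul_continuous.
exact: rmul_continuous.
Qed.

Lemma closed_rindex_ge i : closed [set x | (i <= rindex x)%R].
Proof.
rewrite (_ : mkset _ = [set x | e i * x = x]); first exact: closed_fixed.
by apply/seteqP; split => x /(e_mulP D).
Qed.

Lemma closed_lindex_ge j : closed [set x | (j <= lindex x)%R].
Proof.
rewrite (_ : mkset _ = [set x | x * e j = x]); first exact: closed_fixed.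
by apply/seteqP; split => x /(mul_eP D).
Qed.

Hypothesis cell_compact_ex : exists k, compact (cell k k).

Lemma cell_compact i j : compact (cell i j).
Proof.
have [k ck] := cell_compact_ex.
have [y cy] := cell_nonempty D i k; have [z cz] := cell_nonempty D k j.
rewrite (_ : cell i j = (fun x => y * x * z) @` cell k k).
  apply: continuous_compact ck; apply: continuous_subspaceT.
  exact: lrmul_continuous.
apply/seteqP; split => [x cx|_ [x cx <-]]; last exact: cellMM (cellMM cy cx) cz.
exists (y^* * x * z^*); first exact: cellMM (cellMM (cellV cy) cx) (cellV cz).
transitivity ((y * y^*) * x * (z^* * z)); first by rewrite !mulgA.
rewrite (mulxV_cell cy) (mulVx_cell cz) (e_mul_cell cx).
exact: mul_e_cell cx.
Qed.

Lemma cell_closed i j : closed (cell i j).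
Proof. by apply: compact_closed => //; exact: cell_compact. Qed.

(** The conditions on [x] and on [e i * x * e j] leave the cells
    [(i - k, j - k)] with [k >= 0].  For [k > 0] compressing further, by the
    idempotents of index [i - 1] and [j - 1], lands in [cell (i - 1) (j - 1)],
    whereas it fixes the elements of [cell i j]; as that cell is compact, it is
    closed, and can be excluded. *)
Lemma cell_open i j : open (cell i j).
Proof.
pose far (x : S) := (i + 1 <= rindex x)%R \/ (j + 1 <= lindex x)%R.
have far_closed : closed [set x | far x].
  by apply: closedU; [exact: closed_rindex_ge | exact: closed_lindex_ge].
have far_e_closed := iffLR (continuous_closedP (fun x : S => e i * x * e j : S))
  (@lrmul_continuous (e i) (e j)).
pose near x := e (i - 1)%R * x * e (j - 1)%R.
have near_closed := iffLR (continuous_closedP (near : S -> S))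
  (@lrmul_continuous _ _).
rewrite (_ : cell i j = ~` ([set x | far x] `|` [set x | far (e i * x * e j)]
    `|` [set x | cell (i - 1)%R (j - 1)%R (near x)])).
  apply: closed_openC; apply: closedU; first apply: closedU => //.
    exact: (far_e_closed _ far_closed).
  exact: (near_closed _ (@cell_closed (i - 1)%R (j - 1)%R)).
(* Bicyclic arithmetic: the position of [e a * x * e b] from that of [x]. *)
have trE a b x : rindex (e a * x * e b) = Order.max (Order.max a (rindex x))
     (Order.max a (rindex x) + b - Order.max (lindex x) (lindex x + a - rindex x))%R
  /\ lindex (e a * x * e b) = Order.max b
       (Order.max (lindex x) (lindex x + a - rindex x))%R.
  rewrite !rindexM !lindexM !rindex_e !lindex_e; split; lia.
apply/seteqP; rewrite /far /near /cell; split=> x /=.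
  move=> [rx lx]; rewrite !(trE _ _ _).1 !(trE _ _ _).2 rx lx; lia.
rewrite !(trE _ _ _).1 !(trE _ _ _).2; lia.
Qed.

Lemma cell_nbhs s : nbhs s (cell (rindex s) (lindex s)).
Proof. by apply: open_nbhs_nbhs; split => //; exact: cell_open. Qed.

Lemma cells_locally_compact : locally_compact [set: S].
Proof.
move=> s _; exists (cell (rindex s) (lindex s)).
  rewrite withinET; exact: cell_nbhs.
by split; [exact: cell_compact | exact: cell_closed].
Qed.

(** * Continuity of the coordinates and of the operations *)

Lemma core_nbhsP (g : core) (A : set core) :
  nbhs g A -> exists2 N : set S, nbhs (set_val g : S) N &
    forall h : core, N (set_val h) -> A h.
Proof.
move=> [B [[N oN <-] Ng] NA]; exists N; last by move=> h /NA.
exact: open_nbhs_nbhs.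
Qed.

Lemma core_val_continuous : continuous (set_val : core -> S).
Proof. exact: initial_continuous. Qed.

Lemma core_continuous (T : topologicalType) (f : T -> core) :
  continuous (fun x => set_val (f x) : S) -> continuous f.
Proof.
move=> cf x A /core_nbhsP [N nN NA].
by apply: (@filterS _ (nbhs x) _ _ _ _ (cf x N nN)) => y; exact: NA.
Qed.

Lemma core_hausdorff : hausdorff_space core.
Proof.
move=> g h gh; apply: core_inj; apply: S_hausdorff => A B nA nB.
have [k [Ak Bk]] := gh _ _ (core_val_continuous nA) (core_val_continuous nB).
by exists (set_val k).
Qed.

Lemma core_compact : compact [set: core].
Proof.
move=> F FF FT.
have FA : (set_val @ F) (cell 0%R 0%R)
  by apply: (@filterS _ F _ [set: core]) => // g _; exact: coreP.
have [x [cx clx]] := cell_compact (fmap_proper_filter (set_val : core -> S) FF) FA.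
exists (Core cx); split => // A B FA' /core_nbhsP [N nN NB].
have [y [[g Ag <-] Ny]] := clx (set_val @` A) N
  (filterS (@preimage_image _ _ (set_val : core -> S) A) FA') nN.
by exists g; split => //; exact: NB.
Qed.

Lemma core_lmul_continuous (a : core) : continuous (fun g : core => a * g).
Proof.
apply: core_continuous => g.
apply: (continuous_comp (f := set_val : core -> S)
  (g := fun x : S => set_val a * x)); first exact: core_val_continuous.
exact: lmul_continuous.
Qed.

Lemma core_rmul_continuous (a : core) : continuous (fun g : core => g * a).
Proof.
apply: core_continuous => g.
apply: (continuous_comp (f := set_val : core -> S)
  (g := fun x : S => x * set_val a)); first exact: core_val_continuous.
exact: rmul_continuous.
Qed.

Lemma core_mul_continuous : continuous (fun p : core * core => p.1 * p.2).
Proof.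
exact: compact_semitopological_group_mul core_hausdorff core_compact
  core_lmul_continuous core_rmul_continuous.
Qed.

Lemma core_inv_continuous : continuous (fun g : core => g^-1).
Proof.
exact: compact_semitopological_group_inv core_hausdorff core_compact
  core_lmul_continuous core_rmul_continuous.
Qed.

Lemma warne_map_continuous : continuous warne_map.
Proof.
move=> [[i g] j] N nN.
exists ([set i] `*` [set h : core | N (warne_map (i, h, j))], [set j]) => /=.
  split; last exact: discrete_set1.
  exists ([set i], [set h : core | N (warne_map (i, h, j))]) => //=.
  split; first exact: discrete_set1.
  apply: (core_val_continuous (lrmul_continuous (a := (coord i)^*) (b := coord j) nN)).
by move=> [[i' h] j'] /= [[-> Nh] ->].
Qed.

Lemma warne_coordinates_continuous : continuous warne_coordinates.
Proof.
move=> s N [[IG J] /= [[[I' A] /= [I's nA] IA] Js] sN].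
have [B nB BA] := core_nbhsP nA.
have := lrmul_continuous nB; apply: filterS2 (cell_nbhs s) => s' [rs ls] Bs'.
apply: sN; split => /=; last by rewrite ls; exact: nbhs_singleton Js.
apply: IA; split => /=; first by rewrite rs; exact: nbhs_singleton I's.
by apply: BA; rewrite core_valE rs ls.
Qed.

Lemma warne_iso :
  warne_topological_isomorphism theta ladder warne_map.
Proof.
split; first exact: warne_map_mul.
exists warne_coordinates; split.
- exact: warne_mapK.
- exact: warne_coordinatesK.
- exact: warne_map_continuous.
- exact: warne_coordinates_continuous.
Qed.

Lemma warne_diagonal : carries_diagonal_topology warne_map.
Proof.
move=> i; split.
  by rewrite range_warne_map; apply/(maximal_subgroupP D); exists i.
have diag_continuous : continuous (fun g : core => warne_map (i, g, i)).
  move=> g.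
  apply: (continuous_comp (f := set_val : core -> S)
    (g := fun x : S => (coord i)^* * x * coord i)).
    exact: core_val_continuous.
  exact: lrmul_continuous.
apply/seteqP; split => A.
  move=> oA; exists (warne_coordinates @^-1` [set p | A p.1.2]).
    apply: open_comp => [s _|]; first exact: warne_coordinates_continuous.
    apply: (open_comp (f := fun p : warne_space core => p.1.2)) oA => p _.
    exact: continuous_comp cvg_fst cvg_snd.
  have mapK g : (warne_coordinates (warne_map (i, g, i))).1.2 = g.
    by rewrite warne_mapK.
  by apply/funext => g; exact: (congr1 A (mapK g)).
move=> [U oU <-]; apply: open_comp oU => g _; exact: diag_continuous.
Qed.

(** Near [(s, t)], [s' t'] is a fixed two-sided translate of a product of two
    elements of the group, obtained by inserting [(coord n)^* * coord n = e n]
    between the factors: with [n] the larger of the two inner indices, this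
    idempotent is absorbed by one of them. *)
Lemma mul_continuous : continuous (fun p : S * S => p.1 * p.2).
Proof.
move=> [s t] N /= nN.
set a := rindex (s * t); set b := lindex (s * t).
set n := Order.max (lindex s) (rindex t).
have left_cell s' : cell (rindex s) (lindex s) s' ->
    cell 0%R 0%R (coord a * s' * (coord n)^*).
  move=> cs; have cn := cellV (coord_cell n).
  by apply: cell_cast (cellM (cellM (coord_cell a) cs) cn) _ _;
    rewrite /a /n !rindexM; lia.
have right_cell t' : cell (rindex t) (lindex t) t' ->
    cell 0%R 0%R (coord n * t' * (coord b)^*).
  move=> ct; have cb := cellV (coord_cell b).
  by apply: cell_cast (cellM (cellM (coord_cell n) ct) cb) _ _;
    rewrite /b /n !lindexM; lia.
have split_mul s' t' (cs : cell (rindex s) (lindex s) s')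
    (ct : cell (rindex t) (lindex t) t') :
  s' * t' = (coord a)^* * set_val (Core (left_cell s' cs) * Core (right_cell t' ct))
     * coord b.
  rewrite core_valM !core_valE.
  transitivity (((coord a)^* * coord a) * s' * ((coord n)^* * coord n) *
     t' * ((coord b)^* * coord b)); last by rewrite !mulgA.
  rewrite !(mulVx_cell (coord_cell _)).
  have -> : e a * s' * e n * t' * e b = e a * (s' * e n * t') * e b.
    by rewrite !mulgA.
  have -> : s' * e n * t' = s' * t'.
    have [le|/ltW le] := leP (rindex t) (lindex s).
      rewrite (mul_eP D _ _).2 // /n; case: cs => _ ->; lia.
    rewrite -mulgA (e_mulP D _ _).2 // /n; case: ct => -> _; lia.
  have c : cell a b (s' * t').
    by apply: cell_cast (cellM cs ct) _ _; rewrite /a /b (rindexM, lindexM).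
  by rewrite (e_mul_cell c) (mul_e_cell c).
have cs : cell (rindex s) (lindex s) s by [].
have ct : cell (rindex t) (lindex t) t by [].
have : nbhs (Core (left_cell s cs) * Core (right_cell t ct))
    [set h : core | N ((coord a)^* * set_val h * coord b)].
  apply: (core_val_continuous
    (lrmul_continuous (a := (coord a)^*) (b := coord b) _)).
  by rewrite -split_mul.
move=> /(@core_mul_continuous (_, _)) [[A B] /= [nA nB] AB].
have [A' nA' A'A] := core_nbhsP nA; have [B' nB' B'B] := core_nbhsP nB.
exists (cell (rindex s) (lindex s) `&` [set s' | A' (coord a * s' * (coord n)^*)],
        cell (rindex t) (lindex t) `&` [set t' | B' (coord n * t' * (coord b)^*)]).
  split => /=.
    exact: (filterI (cell_nbhs s) (lrmul_continuous nA')).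
  exact: (filterI (cell_nbhs t) (lrmul_continuous nB')).
move=> [s' t'] /= [[cs' As'] [ct' Bt']]; rewrite (split_mul s' t' cs' ct').
apply: (AB (Core (left_cell s' cs'), Core (right_cell t' ct'))); split => /=.
  exact: A'A.
exact: B'B.
Qed.

Lemma warne_mapV (p : warne_space core) :
  (warne_map p)^* = warne_map (p.2, p.1.2^-1, p.1.1).
Proof.
by case: p => [[i g] j]; rewrite /warne_map /= !inverseM inverseK -core_valV mulgA.
Qed.

Lemma inverse_continuous : continuous (inverse D : S -> S).
Proof.
have inverseE : (inverse D : S -> S) = warne_map \o
    (fun p : warne_space core => (p.2, p.1.2^-1, p.1.1)) \o warne_coordinates.
  by apply/funext => s; rewrite -[in LHS](warne_coordinatesK s) warne_mapV.
rewrite inverseE => s.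
apply: (continuous_comp (f := warne_coordinates)).
  exact: warne_coordinates_continuous.
apply: continuous_comp; last exact: warne_map_continuous.
move: (warne_coordinates s) => p.
apply: (continuous_pair (f := fun p : warne_space core => (p.2, p.1.2^-1))
  (g := fun p : warne_space core => p.1.1)).
  apply: continuous_pair; first exact: cvg_snd.
  apply: (continuous_comp (f := fun p : warne_space core => p.1.2)).
    exact: continuous_comp cvg_fst cvg_snd.
  exact: core_inv_continuous.
exact: continuous_comp cvg_fst cvg_fst.
Qed.

End WarneCoordinates.

Theorem theorem3p3 (S : preTopologicalSemigroupType)
    (S_semitop : semitopological_semigroup S)
    (S_regular : regular_semigroup S)
    (S_Ibisimple : I_bisimple S)
    (S_compact : exists2 A : set S, maximal_subgroup A & compact A) :
  (exists (G : preTopologicalGroupType) (theta : {multiplicative G -> G})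
          (u : int -> G) (Phi : warne_space G -> S),
     [/\ forall n : int, (0 < n)%R -> u n = 1,
         warne_topological_isomorphism theta u Phi &
         carries_diagonal_topology Phi]) /\
  (locally_compact [set: S] /\ topological_inverse_semigroup S).
Proof.
have [S_bisimple [e [e_bij e_leP]]] := S_Ibisimple.
pose D := RegularIBisimple e_bij e_leP S_regular S_bisimple.
have cell_compact_ex : exists k, compact (cell D k k).
  have [A /(maximal_subgroupP D) [k ->] cA] := S_compact.
  by exists k.
split.
  exists (core D), (@theta S D), (@ladder S D), (@warne_map S D); split.
  - exact: ladder_pos.
  - exact: warne_iso.
  - exact: warne_diagonal.
split; first exact: (cells_locally_compact (D := D)).
split.
- by case: S_semitop.
- exact: (mul_continuous (D := D)).
exists (inverse D); last exact: inverse_continuous.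
by move=> x y; split=> [/(inverseE D)/esym|->]; last exact: inverseP.
Qed.
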